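(* Let $A$ be a ring that is $\alpha$-Jacobson for some ordinal $\alpha$. Then $A$ is strongly Jacobson.
   Context: All rings are commutative with identity (the trivial ring is allowed). For a subset $U$ of a ring $A$, $\langle U\rangle$ denotes the ideal generated by $U$. $\mathrm{Nil}_A 0:=\{x\in A:\exists n\ge 0,\ x^n=0\}$ is the nilradical. The image of an element in a quotient ring is denoted by the same letter. For a ring $A$, elements $x,x'\in A$ and an ordinal $\alpha$, the property ''the triple $(A,x,x')$ is $\alpha$-Jacobson'' is defined by recursion on $\alpha$: (1) $(A,x,x')$ is $0$-Jacobson if $x'\in\mathrm{Nil}_A 0$. (2) For $\alpha>0$, $(A,x,x')$ is $\alpha$-Jacobson if there exist $n\ge 0$ and $a_1,\ldots,a_n\in A$ such that for any $b_1,\ldots,b_n\in A$ there exists an ordinal $\beta<\alpha$ such that $(A/\langle 1-b_i(1-a_ix): i\in\{1,\ldots,n\}\rangle,\,x,\,x')$ is $\beta$-Jacobson. A ring $A$ is called $\alpha$-Jacobson if $(A,x,x)$ is $\alpha$-Jacobson for all $x\in A$. For a ring $A$ and $x,x'\in A$, the proposition ''the triple $(A,x,x')$ is strongly Jacobson'' is inductively generated by the following constructors (simultaneously for all quotients of $A$ by finitely generated ideals): (1) if $x'\in\mathrm{Nil}_A 0$, then $(A,x,x')$ is strongly Jacobson; (2) if there exist $n\ge 0$ and $a_{1,1},\ldots,a_{1,n}\in A$ such that for any $a_{2,1},\ldots,a_{2,n}\in A$ the triple $(A/\langle 1-a_{2,i}(1-a_{1,i}x):i\in\{1,\ldots,n\}\rangle,\,x,\,x')$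 is strongly Jacobson, then $(A,x,x')$ is strongly Jacobson. A ring $A$ is called strongly Jacobson if $(A,x,x)$ is strongly Jacobson for all $x\in A$. *)

(* Defs.v *)
From HB Require Import structures.
From mathcomp Require Import all_boot all_order all_algebra ring_quotient.
From mathcomp Require Import boolp classical_sets wochoice.

Set Implicit Arguments.
Unset Strict Implicit.
Unset Printing Implicit Defensive.

Import GRing.Theory.

Local Open Scope classical_set_scope.
Local Open Scope ring_scope.
Local Open Scope quotient_scope.

(* MathComp's {ideal_quot I} is a ring only for I proper and over a nontrivial
   ring.  Here ideals may be improper and rings trivial (comPzRingType), so the
   ring structure is put directly on the Z-module quotient {quot I}. *)

Section GeneratedIdeal.
Variables (A : comPzRingType) (U : set A).

Definition ideal_gen : {pred A} := fun z =>
  `[< exists (k : nat) (c u : 'I_k -> A),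
        (forall i, U (u i)) /\ z = \sum_(i < k) c i * u i >].

Lemma ideal_genM a z : z \in ideal_gen -> a * z \in ideal_gen.
Proof.
move=> /asboolP[k [c [u [Uu ->]]]]; apply/asboolP.
exists k, (fun i => a * c i), u; split=> //.
by rewrite mulr_sumr; apply: eq_bigr => i _; rewrite mulrA.
Qed.

Lemma ideal_gen_zmod_closed : zmod_closed ideal_gen.
Proof.
split=> [|x y]; first by apply/asboolP; exists 0%N, (fun=> 0), (fun=> 0); split;
  [case | rewrite big_ord0].
move=> /asboolP[k [c [u [Uu ->]]]].
rewrite -mulN1r => /(ideal_genM (-1)) /asboolP[l [d [v [Vv ->]]]].
apply/asboolP; exists (k + l)%N.
exists (fun i => match split i with inl j => c j | inr j => d j end).
exists (fun i => match split i with inl j => u j | inr j => v j end).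
split=> [i|]; first by case: (split i).
by rewrite big_split_ord /=; congr (_ + _); apply: eq_bigr => i _;
  rewrite (unsplitK (inl i), unsplitK (inr i)).
Qed.

HB.instance Definition _ :=
  GRing.isZmodClosed.Build A ideal_gen ideal_gen_zmod_closed.

Definition ring_quot : Type := Quotient.quot ideal_gen.
HB.instance Definition _ := GRing.Zmodule.on ring_quot.
HB.instance Definition _ := EqQuotient.on ring_quot.

Definition rq_one : ring_quot := lift_cst ring_quot 1.
Definition rq_mul := lift_op2 ring_quot *%R.

Lemma ring_quotP (x y : A) :
  (\pi_ring_quot x == \pi_ring_quot y) = (x - y \in ideal_gen).
Proof. by rewrite piE Quotient.equivE. Qed.

Lemma pi_rq_mul : {morph \pi_ring_quot : x y / x * y >-> rq_mul x y}.
Proof.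
move=> x y; rewrite /rq_mul -lock; apply/eqP; rewrite ring_quotP.
set x' := repr _; set y' := repr _.
have xx' : x - x' \in ideal_gen by rewrite -ring_quotP reprK.
have yy' : y - y' \in ideal_gen by rewrite -ring_quotP reprK.
rewrite (_ : _ - _ = y * (x - x') + x' * (y - y')).
  by rewrite rpredD // ideal_genM.
by rewrite !mulrBr addrA [y * x]mulrC [y * x']mulrC subrK.
Qed.

Fact rq_mulA : associative rq_mul.
Proof.
move=> x y z; rewrite -[x]reprK -[y]reprK -[z]reprK.
by rewrite -!pi_rq_mul mulrA.
Qed.

Fact rq_mulC : commutative rq_mul.
Proof. by move=> x y; rewrite -[x]reprK -[y]reprK -!pi_rq_mul mulrC. Qed.

Fact rq_mul1 : left_id rq_one rq_mul.
Proof.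
by move=> x; rewrite -[x]reprK /rq_one -lock -pi_rq_mul mul1r.
Qed.

Fact rq_mulDl : left_distributive rq_mul +%R.
Proof.
move=> x y z; rewrite -[x]reprK -[y]reprK -[z]reprK.
by rewrite -raddfD -!pi_rq_mul mulrDl raddfD.
Qed.

HB.instance Definition _ := GRing.Zmodule_isComPzRing.Build ring_quot
  rq_mulA rq_mulC rq_mul1 rq_mulDl.

End GeneratedIdeal.

Definition nilradical (A : comPzRingType) : set A :=
  [set x | exists n : nat, x ^+ n = 0].

Definition jac_rels (A : comPzRingType) (x : A) (n : nat) (a b : 'I_n -> A) :
    set A :=
  [set 1 - b i * (1 - a i * x) | i in [set: 'I_n]].

Definition jac_quot (A : comPzRingType) (x : A) (n : nat) (a b : 'I_n -> A) :
    comPzRingType :=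
  ring_quot (jac_rels x a b).

Definition jac_pi (A : comPzRingType) (x : A) (n : nat) (a b : 'I_n -> A) :
    A -> jac_quot x a b :=
  \pi_(ring_quot (jac_rels x a b)).

(* Ordinals are represented by well-ordered types.  They are compared up to
   order isomorphism: beta < alpha when beta is isomorphic to a proper initial
   segment {y | y < a} of alpha, and alpha = 0 (resp. alpha > 0) means that alpha
   is empty (resp. nonempty). *)
Record ordnum := Ordnum {
  ord_sort :> Type;
  ord_le : rel ord_sort;
  ord_wo : well_order ord_le
}.

Definition ord_is0 (alpha : ordnum) : Prop := ~ inhabited alpha.

Definition ord_lt (beta alpha : ordnum) : Prop :=
  exists (a : alpha) (f : beta -> alpha),
    (forall x y, ord_le (f x) (f y) = ord_le x y) /\
    (forall y, (exists x, f x = y) <-> ~~ ord_le a y).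

Lemma ord_refl (alpha : ordnum) (x : alpha) : ord_le x x.
Proof.
have [|z [[/asboolP zx zmin] _]] := @ord_wo alpha (fun t => `[< t = x >]).
  by exists x; apply/asboolP.
by rewrite -[X in ord_le X]zx; apply: zmin; apply/asboolP.
Qed.

Lemma ord_anti (alpha : ordnum) (x y : alpha) :
  ord_le x y -> ord_le y x -> x = y.
Proof.
move=> xy yx.
have [|z [_ zuniq]] := @ord_wo alpha (fun t => `[< t = x \/ t = y >]).
  by exists x; apply/asboolP; left.
rewrite -(zuniq x) ?(zuniq y) //; split=> [|t /asboolP[]->] //;
  by [apply/asboolP; auto | apply: ord_refl].
Qed.

Lemma ord_lt_le_trans (alpha : ordnum) (x y z : alpha) :
  ~~ ord_le y x -> ~~ ord_le z y -> ~~ ord_le z x.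
Proof.
move=> yx zy; apply/negP => zx.
have [|m [[/asboolP mE mmin] _]] :=
    @ord_wo alpha (fun t => `[< [\/ t = x, t = y | t = z] >]).
  by exists x; apply/asboolP; constructor.
have mx : ord_le m x by apply/mmin/asboolP/Or31.
have my : ord_le m y by apply/mmin/asboolP/Or32.
have mz : ord_le m z by apply/mmin/asboolP/Or33.
case: mE => mE; rewrite {m mmin}mE in mx my mz.
- by move: zy; rewrite -(ord_anti mz zx) my.
- by rewrite mx in yx.
- by rewrite my in zy.
Qed.

Lemma ord_elt_wf (alpha : ordnum) :
  well_founded (fun x y : alpha => ~~ ord_le y x).
Proof.
move=> a; apply: contrapT => na.
have [|z [[/asboolP nz zmin] _]] :=
    @ord_wo alpha (fun z => `[< ~ Acc (fun x y => ~~ ord_le y x) z >]).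
  by exists a; apply/asboolP.
apply: nz; constructor=> y yz; apply: contrapT => ny.
by case/negP: yz; apply: zmin; apply/asboolP.
Qed.

Lemma ord_lt_wf : well_founded ord_lt.
Proof.
move=> alpha; constructor=> beta [a].
elim/(well_founded_ind (@ord_elt_wf alpha)): a beta => a IHa beta [f [fle fim]].
constructor=> gamma [b [g [gle gim]]].
have fb : ~~ ord_le a (f b) by apply/fim; exists b.
apply: (IHa (f b) fb gamma); exists (f \o g); split=> [x y|y] /=.
  by rewrite fle gle.
split=> [[x <-]|yb]; first by rewrite fle; apply/gim; exists x.
have [z zy] : exists z, f z = y by apply/fim/(ord_lt_le_trans yb).
have /gim[x xz] : ~~ ord_le b z by rewrite -fle zy.
by exists x; rewrite xz.
Qed.

(* One step of the recursion defining alpha-Jacobson triples; rec beta is the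
   notion already defined for beta < alpha. *)
Definition jacobson_step (alpha : ordnum)
    (rec : forall beta, ord_lt beta alpha -> forall A : comPzRingType, A -> A -> Prop)
    (A : comPzRingType) (x x' : A) : Prop :=
  (ord_is0 alpha /\ nilradical x') \/
  (~ ord_is0 alpha /\
   exists (n : nat) (a : 'I_n -> A), forall b : 'I_n -> A,
   exists (beta : ordnum) (lt_beta : ord_lt beta alpha),
     rec beta lt_beta (jac_quot x a b) (jac_pi x a b x) (jac_pi x a b x')).

Definition jacobson_triple :
    ordnum -> forall A : comPzRingType, A -> A -> Prop :=
  Fix ord_lt_wf (fun _ => forall A : comPzRingType, A -> A -> Prop)
    jacobson_step.

Lemma jacobson_tripleE (alpha : ordnum) (A : comPzRingType) (x x' : A) :
  jacobson_triple alpha x x' <->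
  (ord_is0 alpha /\ nilradical x') \/
  (~ ord_is0 alpha /\
   exists (n : nat) (a : 'I_n -> A), forall b : 'I_n -> A,
   exists beta : ordnum, ord_lt beta alpha /\
     jacobson_triple beta (jac_pi x a b x) (jac_pi x a b x')).
Proof.
rewrite {1}/jacobson_triple Fix_eq; last first.
  move=> gamma f g fg; congr jacobson_step.
  by apply: functional_extensionality_dep => beta;
     apply: functional_extensionality_dep => lt_beta.
rewrite /jacobson_step; split=> -[|[a0 [n [a H]]]]; try by left.
  right; split=> //; exists n, a => b.
  by have [beta [lt_beta Hb]] := H b; exists beta.
right; split=> //; exists n, a => b.
by have [beta [lt_beta Hb]] := H b; exists beta, lt_beta.
Qed.

Definition alpha_jacobson (alpha : ordnum) (A : comPzRingType) : Prop :=
  forall x : A, jacobson_triple alpha x x.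

(* The ring is a non-uniform parameter: the predicate is generated
   simultaneously over all rings, hence over all iterated quotients of A. *)
Inductive strongly_jacobson_triple (A : comPzRingType) (x x' : A) : Prop :=
| StronglyJacobsonNil of nilradical x'
| StronglyJacobsonStep (n : nat) (a1 : 'I_n -> A) of
    (forall a2 : 'I_n -> A,
       @strongly_jacobson_triple (jac_quot x a1 a2)
         (jac_pi x a1 a2 x) (jac_pi x a1 a2 x')).

Definition strongly_jacobson (A : comPzRingType) : Prop :=
  forall x : A, strongly_jacobson_triple x x.

(* Main.v *)
Require Import Defs.
From mathcomp Require Import all_boot all_order all_algebra.

(** Both notions have the same two clauses; the ordinal only ranks the tree of iterated quotients.
    Forgetting the ranks, by well-founded induction along [ord_lt], leaves a derivation of
    [strongly_jacobson_triple]. *)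

Lemma jacobson_triple_strongly (alpha : ordnum) (A : comPzRingType) (x x' : A) :
  jacobson_triple alpha x x' -> strongly_jacobson_triple x x'.
Proof.
(* The ring and both elements are generalized because the induction hypothesis is applied in the
   quotient [jac_quot x a b]. *)
elim/(well_founded_ind ord_lt_wf): alpha A x x' => alpha IH A x x'.
case/jacobson_tripleE => [[_ nil_x']|[_ [n [a Ha]]]].
  exact: StronglyJacobsonNil.
apply: (@StronglyJacobsonStep A x x' n a) => b.
by have [beta [lt_beta /(IH _ lt_beta)]] := Ha b.
Qed.

Theorem theorem27 (A : comPzRingType)
    (hA : exists alpha : ordnum, alpha_jacobson alpha A) :
  strongly_jacobson A.
Proof.
by case: hA => alpha jacA x; apply: jacobson_triple_strongly (jacA x).
Qed.
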